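(* Suppose that $u>1$, $s$ and $t$ are integers, $n=3^u$, $1 \leq s,t \leq n/2$, and $s \neq t$. Then $\chi(C_n, \{s,t\})=3$.
   Context: $C_n$ is the cycle with vertex set $\mathbb{Z}_n=\{0,1,\dots,n-1\}$, $i$ adjacent to $i\pm1 \pmod n$; the graph distance is $\mathrm{dist}(i,j)=\min(|i-j|,\,n-|i-j|)$. For a set $D$ of positive integers, the distance graph $G(C_n,D)$ has vertex set $\mathbb{Z}_n$, with distinct $i,j$ adjacent iff $\mathrm{dist}(i,j)\in D$; $\chi(C_n,D)$ is its chromatic number. *)

(* Defs.v *)
From HB Require Import structures.
From mathcomp Require Import all_boot all_order all_algebra.

Set Implicit Arguments.
Unset Strict Implicit.
Unset Printing Implicit Defensive.

Record sgraph := SGraph {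
  vertex :> finType;
  adj : rel vertex;
  adj_sym : symmetric adj;
  adj_irrefl : irreflexive adj
}.

Definition proper_coloring (G : sgraph) k (f : {ffun G -> 'I_k}) : bool :=
  [forall x, forall y, adj x y ==> (f x != f y)].

Definition colorable (G : sgraph) k : bool :=
  [exists f : {ffun G -> 'I_k}, proper_coloring f].

Lemma colorable_exists (G : sgraph) : exists k, colorable G k.
Proof.
exists #|G|; apply/existsP; exists [ffun x => enum_rank x].
apply/forallP=> x; apply/forallP=> y; apply/implyP=> exy.
rewrite !ffunE (inj_eq enum_rank_inj); apply/eqP=> eq_xy.
by rewrite eq_xy adj_irrefl in exy.
Qed.

Definition chromatic_number (G : sgraph) : nat := ex_minn (colorable_exists G).

Definition cycle_dist n (i j : 'I_n) : nat := minn `|i - j|%N (n - `|i - j|%N).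

Definition distance_adj n (D : {pred nat}) : rel 'I_n :=
  fun i j => (i != j) && (cycle_dist i j \in D).

Lemma distance_adj_sym n D : symmetric (@distance_adj n D).
Proof.
by move=> i j; rewrite /distance_adj /cycle_dist eq_sym distnC.
Qed.

Lemma distance_adj_irrefl n D : irreflexive (@distance_adj n D).
Proof. by move=> i; rewrite /distance_adj eqxx. Qed.

Definition distance_graph n (D : {pred nat}) : sgraph :=
  SGraph (@distance_adj_sym n D) (@distance_adj_irrefl n D).

(* Main.v *)
Require Import Defs.
From mathcomp Require Import all_boot all_order all_algebra.
From mathcomp Require Import zify.

(** Lower bound: adding [s] repeatedly [n] times gives a closed walk of odd
    length, so two colours are not enough.
    Upper bound: let [3 ^ a] and [3 ^ (a + b)] be the exact powers of 3 dividing
    [s] and [t] (up to symmetry), and put [M = 3 ^ b].  Replacing [x] by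
    [x %/ 3 ^ a] and then multiplying by an inverse of [s %/ 3 ^ a] modulo [3 M]
    turns the step [s] into the step [1], and the step [t] into a step [M m] with
    [m] prime to 3.  Writing [y = k M + i] with [i < M], the colour [k + i] mod 3
    works: the step [M m] changes it by [m], and the step [1] changes it by [1],
    or by [2 - M] when [i] wraps around; neither is divisible by 3. *)

Definition quo_rem_sum (M y : nat) : nat := y %/ M + y %% M.

Lemma quo_rem_sum_addM M y k : 0 < M ->
  quo_rem_sum M (y + M * k) = quo_rem_sum M y + k.
Proof.
by move=> M0; rewrite /quo_rem_sum (mulnC M) divnDMl // (addnC y) modnMDl addnAC.
Qed.

Lemma quo_rem_sum_succ b y :
  quo_rem_sum (3 ^ b) y.+1 != quo_rem_sum (3 ^ b) y %[mod 3].
Proof.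
have [M [M0 eqM hM]] : exists M, [/\ 0 < M, 3 ^ b = M & M = 1 \/ 3 %| M].
  (* This dichotomy suffices: the wrap-around change [2 - M] is 1 if [M = 1], and 2 modulo 3 if
     [3 %| M]. *)
  exists (3 ^ b); split; rewrite ?expn_gt0 //.
  by case: b => [|b]; [left | right; rewrite expnS dvdn_mulr].
rewrite eqM (divn_eq y M) -addnS !(addnC (_ * M)) !(mulnC _ M).
rewrite !quo_rem_sum_addM // eqn_modDr /quo_rem_sum.
have hi := ltn_pmod y M0; move: (y %% M) hi => i hi; rewrite (divn_small hi) (modn_small hi).
have [lt|ge] := ltnP i.+1 M.
  by rewrite divn_small // (modn_small lt); lia.
have -> : i.+1 = M by lia.
by rewrite divnn modnn M0; lia.
Qed.

(** Colours are read modulo 3; the first clause lets [c] descend to the cycle on [n] vertices. *)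
Definition good_coloring (n s t : nat) (c : nat -> nat) : Prop :=
  forall x, [/\ c (x + n) = c x %[mod 3], c (x + s) != c x %[mod 3]
              & c (x + t) != c x %[mod 3]].

Lemma logn_lt p d u : prime p -> 0 < d < p ^ u -> logn p d < u.
Proof.
move=> pp /andP[d0 du]; rewrite -(ltn_exp2l _ _ (prime_gt1 pp)).
exact: leq_ltn_trans (dvdn_leq d0 (pfactor_dvdnn p d)) du.
Qed.

Lemma good_coloring_exists u s t : 0 < s < 3 ^ u -> 0 < t < 3 ^ u ->
  exists c, good_coloring (3 ^ u) s t c.
Proof.
wlog le_st : s t / logn 3 s <= logn 3 t.
  move=> H hs ht; have [|/ltnW] := leqP (logn 3 s) (logn 3 t); first by move/H; apply.
  by case/H => // c hc; exists c => x; have [] := hc x.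
move=> /andP[s0 _] ht; have /andP[t0 _] := ht.
have ltu := logn_lt _ _ _ (erefl : prime 3) ht.
have [s' cs es] := pfactor_coprime (erefl : prime 3) s0.
have [t' ct et] := pfactor_coprime (erefl : prime 3) t0.
move: le_st ltu es et; set a := logn 3 s; set l := logn 3 t => le_st ltu es et.
pose b := l - a; have el : l = b + a by rewrite subnK.
have A0 : 0 < 3 ^ a by rewrite expn_gt0.
have M0 : 0 < 3 ^ b by rewrite expn_gt0.
have s'0 : 0 < s' by move: s0; rewrite es; case: s' {cs es}.
have cs' : coprime s' (3 ^ b.+1) by rewrite coprime_sym coprimeXl.
(* Bezout: [p] inverts [s'] modulo [3 * M], not just [M], so the leftover [q * (3 * M)] shifts the
   quotient by [q * 3], invisible modulo 3. *)
have [p q epq _] := egcdnP (3 ^ b.+1) s'0.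
move: epq; rewrite (eqP cs') expnS => epq.
have cp : coprime 3 p.
  rewrite prime_coprime //; apply/negP => p3.
  have /negP[] : ~~ (3 %| q * (3 * 3 ^ b) + 1) by rewrite dvdn_addr // dvdn_mull ?dvdn_mulr.
  by rewrite -epq dvdn_mulr.
(* As [l < u], the period is a multiple of [3 * M * 3 ^ a], so it changes the colour by a multiple
   of 3. *)
have eu : 3 ^ u = 3 ^ b * (3 * 3 ^ (u - l.+1)) * 3 ^ a.
  by rewrite -expnS -!expnD; congr (3 ^ _); lia.
exists (fun x => quo_rem_sum (3 ^ b) (p * (x %/ 3 ^ a))) => x; split.
- rewrite eu divnDMl // mulnDr mulnCA quo_rem_sum_addM //.
  by rewrite (mulnCA p) -modnDmr modnMr addn0.
- rewrite es divnDMl // mulnDr epq; move: (p * _) => y.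
  have -> : y + (q * (3 * 3 ^ b) + 1) = y.+1 + 3 ^ b * (q * 3) by lia.
  by rewrite quo_rem_sum_addM // -modnDmr modnMl addn0 quo_rem_sum_succ.
- rewrite et el expnD mulnA divnDMl // mulnDr (mulnC t') mulnCA.
  rewrite quo_rem_sum_addM // -[X in _ != X %[mod 3]]addn0 eqn_modDl mod0n.
  by rewrite -/(3 %| _) Euclid_dvdM // negb_or -!prime_coprime // cp.
Qed.

Lemma cycle_dist_eq n (i j : 'I_n) d : 0 < d -> 2 * d <= n -> i < j ->
  cycle_dist i j = d -> j = i + d :> nat \/ i + n = j + d.
Proof.
by move=> d0 dn ij; have := ltn_ord j; rewrite /cycle_dist; lia.
Qed.

Lemma distance_graph_colorable3 n s t c :
  0 < s -> 2 * s <= n -> 0 < t -> 2 * t <= n -> good_coloring n s t c ->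
  colorable (distance_graph n (pred2 s t)) 3.
Proof.
move=> s0 sn t0 tn hc; apply/existsP.
exists [ffun x : 'I_n => inord (c x %% 3)].
have main (i j : 'I_n) : i < j -> cycle_dist i j \in pred2 s t ->
    c i != c j %[mod 3].
  move=> ij; rewrite inE => /orP[] /eqP /cycle_dist_eq [] // e.
  - by rewrite e eq_sym; case: (hc i).
  (* The short arc passes through 0: periodicity replaces [c i] by [c (i + n) = c (j + s)]. *)
  - by case: (hc i) => <- _ _; rewrite e; case: (hc j).
  - by rewrite e eq_sym; case: (hc i).
  - by case: (hc i) => <- _ _; rewrite e; case: (hc j).
apply/forallP => i; apply/forallP => j; apply/implyP => /andP[neq ij].
rewrite !ffunE -val_eqE /= !inordK ?ltn_mod //.
case: (ltngtP i j) => [lt|lt|/val_inj e]; first exact: main.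
  by rewrite eq_sym main // /cycle_dist distnC.
by rewrite e eqxx in neq.
Qed.

Lemma distance_adj_add n (D : {pred nat}) d x (n0 : 0 < n) :
  0 < d -> 2 * d <= n -> d \in D ->
  distance_adj D (Ordinal (ltn_pmod x n0)) (Ordinal (ltn_pmod (x + d) n0)).
Proof.
move=> d0 dn dD; rewrite /distance_adj /cycle_dist -val_eqE /=.
have hx := ltn_pmod x n0.
have E : (x + d) %% n = if x %% n + d < n then x %% n + d else x %% n + d - n.
  rewrite -modnDml; case: ltnP => h; first by rewrite modn_small.
  by rewrite -{1}(subnK h) modnDr modn_small //; lia.
(* The difference is [d], or [n - d] after a wrap; the minimum is [d] either way since
   [2 * d <= n]. *)
have -> : minn `|x %% n - (x + d) %% n| (n - `|x %% n - (x + d) %% n|) = d.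
  by rewrite E; case: ltnP; lia.
by rewrite dD andbT E; case: ltnP; lia.
Qed.

Lemma distance_graph_not_colorable2 n (D : {pred nat}) d k :
  odd n -> 0 < d -> 2 * d <= n -> d \in D ->
  colorable (distance_graph n D) k -> 2 < k.
Proof.
move=> nodd d0 dn dD /existsP[f /forallP fP]; rewrite ltnNge; apply/negP => k2.
have n0 := odd_gt0 nodd.
(* With at most two colours, having colour 0 determines the colour, so [g] must flip along each
   edge. *)
pose g x := f (Ordinal (ltn_pmod x n0)) == 0 :> nat.
have gS x : g (x + d) = ~~ g x.
  have /forallP/(_ (Ordinal (ltn_pmod (x + d) n0))) := fP (Ordinal (ltn_pmod x n0)).
  rewrite [adj _ _]distance_adj_add //= /g -val_eqE /=.
  by move: (f _) (f _) => [? ?] [? ?] /=; lia.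
have gM m : g (d * m) = odd m (+) g 0.
  by elim: m => [|m IH]; rewrite ?muln0 // mulnS addnC gS IH /= addNb.
have := gM n; rewrite nodd.
have -> : g (d * n) = g 0; last by case: (g 0).
by congr (f _ == 0 :> nat); apply: val_inj; rewrite /= modnMl mod0n.
Qed.

Theorem theorem3p3p3 (u s t n : nat) (hu : 1 < u) (hn : n = 3 ^ u)
    (hs : 1 <= s) (hs2 : 2 * s <= n) (ht : 1 <= t) (ht2 : 2 * t <= n)
    (hst : s <> t) :
  chromatic_number (distance_graph n (pred2 s t)) = 3.
Proof.
have nodd : odd n by rewrite hn oddX orbT.
have [c hc] : exists c, good_coloring n s t c.
  by rewrite hn; apply: good_coloring_exists; rewrite -hn; lia.
rewrite /chromatic_number; case: ex_minnP => k colk mink.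
apply/eqP; rewrite eqn_leq mink ?(@distance_graph_colorable3 _ _ _ c) //=.
by apply: (distance_graph_not_colorable2 n _ s k nodd hs hs2 _ colk); rewrite !inE eqxx.
Qed.
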